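(* Let $A\in\mathbb{R}^{n\times n}$ satisfy $\mathrm{Re}(x^*Ax)\geq 0$ for all $x\in\mathbb{C}^n$, let $0<\tilde\gamma\leq\gamma$, and let a linear system $(I+\tilde\gamma A)x=b$ be solved iteratively. Then the Richardson iteration preconditioned with the matrix $I+\gamma A$, namely $$x_{m+1}=\tilde G x_m+(I+\gamma A)^{-1}b,\qquad \tilde G=I-(I+\gamma A)^{-1}(I+\tilde\gamma A),$$ converges. Furthermore, assume that the unpreconditioned Richardson iteration $$x_{m+1}=Gx_m+b,\qquad G=I-(I+\tilde\gamma A)=-\tilde\gamma A,$$ converges, too. Then the Richardson iteration preconditioned with $I+\gamma A$ converges faster than the unpreconditioned Richardson iteration provided that $$\frac{1}{1+\gamma\rho(A)}<\frac{\tilde\gamma}{\gamma},$$ where $\rho(A)$ is the spectral radius of $A$.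
   Context: For a square matrix $B$, $\rho(B)$ denotes its spectral radius (the maximum absolute value of its complex eigenvalues). $x^*$ is the conjugate transpose of $x$ and $\mathrm{Re}(z)$ is the real part of $z\in\mathbb{C}$. A stationary iteration $x_{m+1}=Bx_m+c$ is said to converge (unconditionally, i.e. for every starting vector $x_0$ and every right-hand side) if $\rho(B)<1$. One such iteration, with iteration matrix $B_1$, converges faster than another, with iteration matrix $B_2$, if $\rho(B_1)<\rho(B_2)$. *)

(* Defs.v *)
From mathcomp Require Import all_boot all_order all_algebra.
From mathcomp Require Import all_classical all_reals.
From mathcomp Require Export complex.

Set Implicit Arguments.
Unset Strict Implicit.
Unset Printing Implicit Defensive.

Import Order.TTheory GRing.Theory Num.Theory.
Local Open Scope ring_scope.
Local Open Scope classical_set_scope.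
Local Open Scope complex_scope.

Definition complexmx (R : realType) (m n : nat) (B : 'M[R]_(m, n)) :
    'M[R[i]]_(m, n) :=
  map_mx (fun a : R => a%:C) B.

Definition conjtr (R : realType) (m n : nat) (B : 'M[R[i]]_(m, n)) :
    'M[R[i]]_(n, m) :=
  map_mx (@Num.conj R[i]) B^T.

(* The set of eigenvalues is finite, so for 0 < n the supremum is a maximum;
   for n = 0 it is empty and the value is sup set0 = 0. The norm of z : R[i]
   lives in R[i] with zero imaginary part, hence the projection to R. *)
Definition spectral_radius (R : realType) (n : nat) (B : 'M[R]_n) : R :=
  sup [set complex.Re `|z| | z in [set z : R[i] | eigenvalue (complexmx B) z]].

(* The iteration x_{m+1} = iter_mx x_m + iter_vec. *)
Record stationary_iteration (R : realType) (n : nat) := StationaryIteration {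
  iter_mx : 'M[R]_n;
  iter_vec : 'cV[R]_n }.

Definition converges (R : realType) (n : nat)
    (it : stationary_iteration R n) : Prop :=
  spectral_radius (iter_mx it) < 1.

Definition converges_faster (R : realType) (n : nat)
    (it1 it2 : stationary_iteration R n) : Prop :=
  spectral_radius (iter_mx it1) < spectral_radius (iter_mx it2).

Definition richardson (R : realType) (n : nat) (M : 'M[R]_n) (b : 'cV[R]_n) :
    stationary_iteration R n :=
  StationaryIteration (1%:M - M) b.

(* invmx P = P when P is singular, so this is only meaningful for
   P \in unitmx. *)
Definition preconditioned_richardson (R : realType) (n : nat)
    (P M : 'M[R]_n) (b : 'cV[R]_n) : stationary_iteration R n :=
  StationaryIteration (1%:M - invmx P *m M) (invmx P *m b).

(* Main.v *)
(* If [v *m A = w *: v] with [v != 0], then [w] is the Rayleigh quotient of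
   [A] at [v^*], so [0 <= Re w] and [`|1 + gamma w| > gamma `|w|].  Every
   nonzero eigenvalue of the preconditioned iteration matrix
   [(gamma - gammat) *: P^-1 A] has the form
   [z = (gamma - gammat) w / (1 + gamma w)], whence
   [gamma `|z| < gamma - gammat].  Comparing this with [1], respectively with
   the spectral radius [gammat * rho(A)] of [- gammat *: A], gives both
   claims: the last hypothesis says
   [gamma - gammat < gamma * gammat * rho(A)]. *)
Require Import Defs.
From mathcomp Require Import all_boot all_order all_algebra.
From mathcomp Require Import all_classical all_reals.
From mathcomp Require Import ring.
Import Order.TTheory GRing.Theory Num.Theory.
Local Open Scope ring_scope.

Notation normc := ComplexField.Normc.normc.

Lemma Re_norm (R : realType) (z : R[i]) : complex.Re `|z| = normc z.
Proof. by rewrite normc_def; case: z. Qed.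

Lemma sqr_normc_add1 (R : realType) (g : R) (z : R[i]) :
  normc (1 + g%:C%C * z) ^+ 2 =
  1 + 2 * g * complex.Re z + (g * normc z) ^+ 2.
Proof.
case: z => a c; rewrite exprMn /= !sqr_sqrtr ?addr_ge0 ?sqr_ge0 //.
by ring.
Qed.

Lemma normc_ge0 (R : realType) (z : R[i]) : 0 <= normc z.
Proof. by case: z => a c; exact: sqrtr_ge0. Qed.

Lemma normc_real (R : realType) (a : R) : normc a%:C%C = `|a|.
Proof. by rewrite /= expr0n /= addr0 sqrtr_sqr. Qed.

(** The roots of the characteristic polynomial, listed. This finiteness makes the [sup] in
    [spectral_radius] a genuine bound. *)
Lemma eigenvalue_seq (F : closedFieldType) (n : nat) (B : 'M[F]_n) :
  exists s : seq F, forall z, eigenvalue B z -> z \in s.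
Proof.
have [s sE] := closed_field_poly_normal (char_poly B).
exists s => z; rewrite eigenvalue_root_char sE.
by rewrite (monicP (char_poly_monic B)) scale1r root_prod_XsubC.
Qed.

Lemma eigenvalue_normc_le (R : realType) (n : nat) (B : 'M[R]_n) (z : R[i]) :
  eigenvalue (complexmx B) z -> normc z <= spectral_radius B.
Proof.
move=> Bz; apply: ub_le_sup; last by exists z => //; rewrite Re_norm.
have [s sP] := @eigenvalue_seq _ n (complexmx B).
exists (\big[Order.max/0]_(y <- s) normc y) => _ [y /sP ys <-].
by rewrite Re_norm; apply: le_bigmax_seq.
Qed.

(** Passing to [sup] preserves only [<=]; strictness comes from a maximum over finitely many
    eigenvalues. [0 < c] covers the empty spectrum, where [sup] is 0. *)
Lemma spectral_radius_lt (R : realType) (n : nat) (B : 'M[R]_n) (c : R) :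
  0 < c -> (forall z, eigenvalue (complexmx B) z -> normc z < c) ->
  spectral_radius B < c.
Proof.
move=> c0 Bc; have [s sP] := @eigenvalue_seq _ n (complexmx B).
pose m := \big[Order.max/0]_(y <- s | eigenvalue (complexmx B) y) normc y.
have mc : m < c by rewrite /m; apply: bigmax_lt.
rewrite /spectral_radius; set E := (X in sup X).
have [->|E0] := eqVneq E set0; first by rewrite sup0.
apply: le_lt_trans mc; apply: ge_sup; first exact/set0P.
move=> _ [y By <-]; rewrite Re_norm.
by apply: le_bigmax_seq => //; exact: sP.
Qed.

Lemma spectral_radius_le (R : realType) (n : nat) (B : 'M[R]_n) (c : R) :
  0 <= c -> (forall z, eigenvalue (complexmx B) z -> normc z <= c) ->
  spectral_radius B <= c.
Proof.
move=> c0 Bc; rewrite /spectral_radius; set E := (X in sup X).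
have [->|E0] := eqVneq E set0; first by rewrite sup0.
apply: ge_sup; first exact/set0P.
by move=> _ [y By <-]; rewrite Re_norm; exact: Bc.
Qed.

Lemma spectral_radius_ge0 (R : realType) (n : nat) (B : 'M[R]_n) :
  0 <= spectral_radius B.
Proof.
case: (pselect (exists z, eigenvalue (complexmx B) z)) => [[z Bz]|noz].
  exact: le_trans (normc_ge0 _ z) (eigenvalue_normc_le _ _ _ _ Bz).
rewrite /spectral_radius; set E := (X in sup X).
suff -> : E = set0 by rewrite sup0.
by rewrite -subset0 => y [z Bz _]; apply: noz; exists z.
Qed.

Lemma complexmxE (R : realType) (m n : nat) (B : 'M[R]_(m, n)) :
  complexmx B = map_mx (real_complex R) B.
Proof. by []. Qed.

Lemma spectral_radius_scale (R : realType) (n : nat) (a : R) (B : 'M[R]_n) :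
  a != 0 -> `|a| * spectral_radius B <= spectral_radius (a *: B).
Proof.
(* Dividing by [|a|] leaves an upper bound on the radius of [B], checked one eigenvalue at a time:
   [z] for [B] yields [a * z] for [a *: B]. *)
move=> a0; rewrite mulrC -ler_pdivlMr ?normr_gt0 //.
apply: spectral_radius_le => [|z /eigenvalueP[v vB v0]].
  by rewrite divr_ge0 ?spectral_radius_ge0.
rewrite ler_pdivlMr ?normr_gt0 // mulrC -normc_real
  -ComplexField.Normc.normcM.
apply: eigenvalue_normc_le; apply/eigenvalueP; exists v => //.
by rewrite complexmxE map_mxZ /= -scalemxAr -complexmxE vB scalerA.
Qed.

Lemma eigenvalue_Re_ge0 (R : realType) (n : nat) (A : 'M[R]_n) (z : R[i]) :
  (forall x : 'cV[R[i]]_n,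
     0 <= complex.Re ((conjtr x *m complexmx A *m x) 0 0)) ->
  eigenvalue (complexmx A) z -> 0 <= complex.Re z.
Proof.
move=> A_ge0 /eigenvalueP[v vA v0].
have vK : conjtr (conjtr v) = v.
  by apply/matrixP => i j; rewrite !mxE conjCK.
(* [eigenvalue] uses row vectors, so the test vector is [conjtr v]; the form becomes [z * q] with
   [q] the squared norm of [v]. *)
have := A_ge0 (conjtr v); rewrite vK vA -scalemxAl mxE.
set q := (X in z * X).
have [i vi] : exists i, v 0 i != 0.
  by apply/existsP; rewrite -negb_forall; apply: contra v0 => /forallP h;
     apply/eqP/rowP => i; rewrite mxE; exact/eqP.
have q0 : 0 < q.
  rewrite /q mxE (bigD1 i) //= !mxE ltr_pwDl ?mul_conjC_gt0 //.
  by apply: sumr_ge0 => j _; rewrite !mxE mul_conjC_ge0.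
(* Positivity in [R[i]] forces [q] to be real, so [Re (z * q)] is [Re z] times a positive number. *)
move: q0; rewrite ltcE; case: (z) (q) => a c [d e] /= /andP[/eqP -> d0].
by rewrite mulr0 subr0 pmulr_lge0.
Qed.

Lemma preconditioner_unitmx (R : realType) (n : nat) (A : 'M[R]_n) (gamma : R) :
  (forall x : 'cV[R[i]]_n,
     0 <= complex.Re ((conjtr x *m complexmx A *m x) 0 0)) ->
  0 < gamma ->
  1%:M + gamma *: A \in unitmx.
Proof.
move=> A_ge0 gamma_gt0.
rewrite -row_free_unit -kermx_eq0; apply/negPn/negP => /rowV0Pn[v /sub_kermxP].
rewrite mulmxDr mulmx1 -scalemxAr => vP v0.
(* A kernel vector of the preconditioner would give [A] a negative eigenvalue. *)
have Agamma : eigenvalue A (- gamma^-1).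
  apply/eigenvalueP; exists v => //.
  apply: (scalerI (lt0r_neq0 gamma_gt0)).
  rewrite scalerA mulrN divff ?gt_eqF // scaleN1r.
  by apply/eqP; rewrite -addr_eq0 addrC vP.
have: eigenvalue (complexmx A) (real_complex R (- gamma^-1)).
  by rewrite complexmxE eigenvalue_map.
move/(eigenvalue_Re_ge0 _ _ _ _ A_ge0).
by rewrite /= oppr_ge0 invr_le0 leNgt gamma_gt0.
Qed.

(** Used with [c = 1] for convergence and with [c = gammat * rho(A)] for the comparison. *)
Lemma preconditioned_spectral_radius_lt (R : realType) (n : nat) (A : 'M[R]_n)
    (gammat gamma c : R) :
  (forall x : 'cV[R[i]]_n,
     0 <= complex.Re ((conjtr x *m complexmx A *m x) 0 0)) ->
  0 < gamma ->
  0 < c -> gammat <= gamma -> gamma - gammat <= gamma * c ->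
  spectral_radius
    (1%:M - invmx (1%:M + gamma *: A) *m (1%:M + gammat *: A)) < c.
Proof.
move=> A_ge0 gamma_gt0 c0 gammat_le gap; apply: spectral_radius_lt => // z.
set P := 1%:M + gamma *: A.
have Pu : P \in unitmx by exact: preconditioner_unitmx.
have [->|z0] := eqVneq z 0; first by rewrite ComplexField.Normc.normc0.
rewrite complexmxE => /eigenvalueP[v vG v0].
(* With [w = v P^-1], the equation [v G = z v] reads [d (w A) = z (w + gamma w A)]; collecting the
   [w A] terms produces the factor [e]. *)
pose w := v *m map_mx (real_complex R) (invmx P).
have wP : w *m map_mx (real_complex R) P = v.
  by rewrite -mulmxA -map_mxM mulVmx // map_mx1 mulmx1.
have w0 : w != 0.
  by apply: contra v0 => /eqP w0; rewrite -wP w0 mul0mx.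
pose d := real_complex R (gamma - gammat).
pose e := d - z * real_complex R gamma.
have wA : e *: (w *m complexmx A) = z *: w.
  have : v *m map_mx (real_complex R) (1%:M - invmx P *m (1%:M + gammat *: A))
       = d *: (w *m complexmx A).
    have -> : 1%:M - invmx P *m (1%:M + gammat *: A)
            = (gamma - gammat) *: (invmx P *m A).
      rewrite -{1}(mulVmx Pu) -mulmxBr scalemxAr; congr (_ *m _).
      by rewrite /P scalerBl opprD addrACA subrr add0r.
    by rewrite map_mxZ -scalemxAr map_mxM mulmxA.
  rewrite vG -{1}wP map_mxD map_mx1 map_mxZ mulmxDr mulmx1 -scalemxAr scalerDr.
  by move=> wAE; rewrite /e scalerBl -scalerA -wAE addrK.
have e0 : e != 0.
  apply: contra w0 => /eqP e0; move: wA; rewrite e0 scale0r.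
  by move/esym/eqP; rewrite scaler_eq0 (negPf z0).
have Az : eigenvalue (complexmx A) (z / e).
  apply/eigenvalueP; exists w => //.
  by apply: (scalerI e0); rewrite wA scalerA mulrCA divff ?mulr1.
have Re0 := eigenvalue_Re_ge0 _ _ _ _ A_ge0 Az.
have zE : z * (1 + gamma%:C%C * (z / e)) = d * (z / e).
  rewrite -(subrK (z * real_complex R gamma) d) mulrDl -/e [e * _]mulrC divfK //.
  by rewrite mulrDr mulr1 mulrA.
move: zE Re0; set l := z / e => zE Re0.
have := congr1 (@ComplexField.Normc.normc R) zE.
rewrite (ComplexField.Normc.normcM z) (ComplexField.Normc.normcM d).
rewrite normc_real ger0_norm ?subr_ge0 //.
have l0 := normc_ge0 _ l; have m0 := normc_ge0 _ (1 + gamma%:C%C * l).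
have mlt : gamma * normc l < normc (1 + gamma%:C%C * l).
  (* The squares differ by [1 + 2 * gamma * Re l], which is at least 1. *)
  rewrite -(@ltr_pXn2r _ 2) ?nnegrE ?mulr_ge0 ?(ltW gamma_gt0) //.
  rewrite sqr_normc_add1 ltrDr.
  by rewrite ltr_pwDl // !mulr_ge0 ?(ltW gamma_gt0).
move: mlt m0; set m := normc (1 + _) => mlt m0 zm.
have m_gt0 : 0 < m by apply: le_lt_trans mlt; rewrite mulr_ge0 ?(ltW gamma_gt0).
(* After scaling by [m]: [(gamma - gammat) |l| <= c * gamma * |l| < c * m]. *)
rewrite -(ltr_pM2r m_gt0) zm.
have: c * (gamma * normc l) < c * m by rewrite ltr_pM2l.
by apply: le_lt_trans; rewrite mulrCA mulrA; exact: (ler_wpM2r l0 gap).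
Qed.

Theorem proposition2 (R : realType) (n : nat) (A : 'M[R]_n)
    (gammat gamma : R) (b : 'cV[R]_n)
    (A_ge0 : forall x : 'cV[R[i]]_n,
       0 <= complex.Re ((conjtr x *m complexmx A *m x) 0 0))
    (gammat_gt0 : 0 < gammat) (gammat_le : gammat <= gamma) :
  let M := 1%:M + gammat *: A in
  let P := 1%:M + gamma *: A in
  [/\ P \in unitmx,
      converges (preconditioned_richardson P M b) &
      converges (richardson M b) ->
      1 / (1 + gamma * spectral_radius A) < gammat / gamma ->
      converges_faster (preconditioned_richardson P M b) (richardson M b)].
Proof.
move=> M P; have gamma_gt0 := lt_le_trans gammat_gt0 gammat_le.
split; first exact: preconditioner_unitmx.
  apply: preconditioned_spectral_radius_lt => //.
  by rewrite mulr1 gerBl ltW.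
move=> _; have rho0 := spectral_radius_ge0 _ _ A; move: rho0.
set rho := spectral_radius A => rho0.
have den0 : 0 < 1 + gamma * rho by rewrite ltr_pwDl // mulr_ge0 // ltW.
rewrite (ltr_pdivrMr _ _ den0) mulrAC (ltr_pdivlMr _ _ gamma_gt0).
rewrite mul1r mulrDr mulr1 -ltrBlDl => gap.
rewrite /converges_faster /=.
apply: (@lt_le_trans _ _ (gammat * rho)).
  apply: preconditioned_spectral_radius_lt => //.
    (* Since [gamma - gammat] is nonnegative, [gap] itself forces [rho > 0], so [gammat * rho] is an
       admissible [c]. *)
    have : 0 < gammat * (gamma * rho) by apply: le_lt_trans gap; rewrite subr_ge0.
    by rewrite mulrCA pmulr_rgt0.
  by rewrite mulrCA ltW.
have -> : 1%:M - M = - gammat *: A by rewrite opprD addNKr scaleNr.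
have gammatN0 : - gammat != 0 by rewrite oppr_eq0 gt_eqF.
have := spectral_radius_scale _ _ _ A gammatN0.
by rewrite normrN (gtr0_norm gammat_gt0); apply.
Qed.
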